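(* Let $T\subset\mathbb{R}^n$ be a closed regular set and let $I\subset\mathbb{Z}_{+}^n$ be a finite regular set. Then $G_{TI}$ is the dense interior of $\Gamma_{TI}$; that is, $G_{TI}$ equals the interior of $\Gamma_{TI}$ in $\mathbb{R}^I$, and $G_{TI}$ is dense in $\Gamma_{TI}$.
   Context: For $i=(i_1,\ldots,i_n)\in\mathbb{Z}_{+}^n$ (nonnegative integers) and $t=(t_1,\ldots,t_n)\in\mathbb{R}^n$, $t^i=t_1^{i_1}\cdots t_n^{i_n}$. The Lebesgue measure on $\mathbb{R}^n$ is $dt$, $\|\cdot\|$ is the Euclidean norm, and $L^1_+(T,dt)$ is the set of functions in $L^1(T,dt)$ that are $\geq 0$ almost everywhere. A closed set $T\subset\mathbb{R}^n$ is called regular if $T\neq\emptyset$ and for every $t\in T$ and every $\varepsilon>0$ the set $\{x\in T:\|x-t\|<\varepsilon\}$ has Lebesgue measure $>0$. For $i\in\mathbb{Z}_{+}^n$ let $\sigma_i=\{j\in\mathbb{Z}_{+}^n: \text{for each } 1\leq k\leq n,\ j_k=0 \text{ or } j_k=i_k\}$. A finite set $I\subset\mathbb{Z}_{+}^n$ is called regular if $I\neq\emptyset$ and $\sigma_i\subset I$ for all $i\in I$. $\Gamma_{TI}\subset\mathbb{R}^I$ is the set of all $\gamma=(\gamma_i)_{i\in I}$ for which there exists a Borel measure $\nu\geq 0$ on $T$ with $\int_T|t^i|\,d\nu(t)<\infty$ and $\int_T t^i\,d\nu(t)=\gamma_i$ for all $i\in I$. $G_{TI}\subset\mathbb{R}^I$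 is the set of all $g=(g_i)_{i\in I}\neq 0$ for which there exists $f\in L^1_+(T,dt)$ with $\int_T|t^i|f(t)\,dt<\infty$ and $\int_T t^i f(t)\,dt=g_i$ for all $i\in I$. *)

(* Defs.v *)
From HB Require Import structures.
From mathcomp Require Import all_boot all_order all_algebra finmap.
From mathcomp Require Import all_classical all_reals all_analysis.
From mathcomp Require Import measurable_realfun.

Set Implicit Arguments.
Unset Strict Implicit.
Unset Printing Implicit Defensive.

Import Order.TTheory GRing.Theory Num.Theory.
Import numFieldNormedType.Exports.

Local Open Scope classical_set_scope.
Local Open Scope ring_scope.

(* The Borel sigma-algebra of R^n, on the library's topological space of row
   vectors. *)
HB.instance Definition _ (R : realType) (n : nat) :=
  @isMeasurable.Build (sigma_display (@open 'rV[R]_n)) 'rV[R]_n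
    <<s @open 'rV[R]_n >> (@sigma_algebra0 _ setT _) (@sigma_algebraC _ _)
    (@sigma_algebra_bigcup _ setT _).

Lemma rV_open_bigcup_rat (R : realType) n (O : set 'rV[R]_n) : open O ->
  O = \bigcup_(p in [set p : 'rV[rat]_n * nat |
          ball (map_mx ratr p.1 : 'rV[R]_n) p.2.+1%:R^-1 `<=` O])
        ball (map_mx ratr p.1 : 'rV[R]_n) p.2.+1%:R^-1.
Proof.
move=> oO; apply/seteqP; split=> [x Ox|x [p]]; last exact.
have /nbhs_ballP[e /= e0 xeO] : nbhs x O by exact: open_nbhs_nbhs.
have [k ke] : exists k, k.+1%:R^-1 < e / 2 :> R.
  have e20 : 0 < e / 2 by rewrite divr_gt0.
  have [N _ NP] := near_infty_natSinv_lt (PosNum e20).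
  by exists N; exact: (NP N (leqnn N)).
have k0 : 0 < k.+1%:R^-1 :> R by rewrite invr_gt0.
have qP i : {q : rat | `|x ord0 i - ratr q| < k.+1%:R^-1}.
  apply: cid; have /rat_in_itvoo[q] : x ord0 i - k.+1%:R^-1 < x ord0 i + k.+1%:R^-1.
    by rewrite ltrBlDr -addrA ltrDl addr_gt0.
  rewrite in_itv/= => /andP[q1 q2]; exists q.
  by rewrite ltr_distlC q1.
pose q : 'rV[rat]_n := \row_i sval (qP i).
have qx : ball (map_mx ratr q : 'rV[R]_n) k.+1%:R^-1 x.
  split=> // i j; rewrite ord1 !mxE; apply: ball_sym.
  exact: (svalP (qP j)).
exists (q, k) => //= y qy; apply: xeO.
have := ball_triangle (ball_sym qx) qy; apply: le_ball.
by rewrite (splitr e) lerD// ltW.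
Qed.

Lemma measurable_rowP (R : realType) d (X : measurableType d) n
    (f : X -> 'rV[R]_n) :
  (forall i, measurable_fun [set: X] (fun x => f x ord0 i)) ->
  measurable_fun [set: X] f.
Proof.
move=> mf; apply: (measurability (@open 'rV[R]_n)) => //.
move=> _ [U oU <-]; rewrite setTI (rV_open_bigcup_rat oU) preimage_bigcup.
rewrite bigcup_mkcond; apply: countable_bigcupT_measurable => // p.
case: ifPn => // _.
have -> : f @^-1` ball (map_mx ratr p.1 : 'rV[R]_n) p.2.+1%:R^-1 =
    \bigcap_(i in [set: 'I_n])
      (fun x => f x ord0 i) @^-1` ball (ratr (p.1 ord0 i) : R) p.2.+1%:R^-1.
  apply/seteqP; split=> x /=.
    by move=> [_ fx] i _ /=; have := fx ord0 i; rewrite mxE.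
  move=> fx; split; first by rewrite invr_gt0.
  by move=> i j; rewrite ord1 mxE; exact: fx.
apply: fin_bigcap_measurable => // i _; rewrite -[X in measurable X]setTI.
by apply: mf => //; apply: open_measurable; exact: ball_open.
Qed.

Lemma measurable_coord (R : realType) n (i : 'I_n) :
  measurable_fun [set: 'rV[R]_n] (fun t => t ord0 i).
Proof.
apply: (measurability _ (RGenOpens.measurableE R)) => _ [_ [a [b ->] <-]].
rewrite setTI; apply: sub_sigma_algebra.
apply: open_comp; last exact: interval_open.
by move=> ? _; exact: coord_continuous.
Qed.

Section lebesgue_rV.
Context {R : realType}.

Definition cons_row n (p : R * 'rV[R]_n) : 'rV[R]_n.+1 :=
  row_mx (p.1)%:M p.2 : 'rV[R]_(1 + n).

Lemma cons_row0 n (p : R * 'rV[R]_n) : cons_row p ord0 ord0 = p.1.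
Proof.
have -> : @ord0 n = lshift n (ord0 : 'I_1) by exact/val_inj.
apply: etrans (row_mxEl (p.1%:M : 'M[R]_1) p.2 ord0 ord0) _.
by rewrite mxE eqxx.
Qed.

Lemma cons_row_lift n (p : R * 'rV[R]_n) i :
  cons_row p ord0 (lift ord0 i) = p.2 ord0 i.
Proof.
have -> : lift ord0 i = rshift 1 i by exact/val_inj.
exact: row_mxEr.
Qed.

Lemma measurable_cons_row n : measurable_fun setT (@cons_row n).
Proof.
apply: measurable_rowP => i; case: (unliftP ord0 i) => [j ->|->].
  under eq_fun do rewrite cons_row_lift.
  exact: (measurableT_comp (measurable_coord j) measurable_snd).
by under eq_fun do rewrite cons_row0; exact: measurable_fst.
Qed.

Definition lebesgue_cons n (mu : {measure set 'rV[R]_n -> \bar R}) :=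
  pushforward (@lebesgue_measure R \x^ mu)%E (@cons_row n).

HB.instance Definition _ n mu := Measure.copy (@lebesgue_cons n mu)
  (measure_function_pushforward__canonical__measure_function_Measure
    (@lebesgue_measure R \x^ mu)%E (@measurable_cons_row n)).

(* lambda_0 is the unit mass of the point R^0, and lambda_(n+1) is the image of
   lambda_1 x lambda_n under (a, v) |-> (a, v_1, ..., v_n); the product [\x^]
   integrates over v the one-dimensional measure of the slice at v. *)
Fixpoint lebesgue_rV n : {measure set 'rV[R]_n -> \bar R} :=
  if n is m.+1 then lebesgue_cons (lebesgue_rV m) else \d_(0 : 'rV[R]_0).

Lemma lebesgue_rV_box n (A : 'I_n -> set R) :
  (forall i, measurable (A i)) ->
  lebesgue_rV n [set t | forall i, A i (t ord0 i)] =
  (\prod_(i < n) lebesgue_measure (A i))%E.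
Proof.
elim: n A => [|n IH] A mA.
  rewrite big_ord0 /= diracE mem_set//; by case.
rewrite big_ord_recl -IH /=; last by move=> i; exact: mA.
rewrite /lebesgue_cons /pushforward.
pose B := [set v : 'rV[R]_n | forall i : 'I_n, A (lift ord0 i) (v ord0 i)].
have mB : measurable B.
  have -> : B = \bigcap_(i in [set: 'I_n])
      (fun v : 'rV[R]_n => v ord0 i) @^-1` A (lift ord0 i).
    by apply/seteqP; split=> v /= vA i; [move=> _|]; exact: vA.
  apply: fin_bigcap_measurable => // i _; rewrite -[X in measurable X]setTI.
  by apply: measurable_coord => //; exact: mA.
rewrite (_ : _ @^-1` _ = A ord0 `*` B).
  exact: (product_measure2E (@lebesgue_measure R) (lebesgue_rV n) (mA ord0) mB).
apply/seteqP; split=> -[a v] /=.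
  move=> Av; split; first by have := Av ord0; rewrite cons_row0.
  by move=> i; have := Av (lift ord0 i); rewrite cons_row_lift.
move=> [Aa Av] i; case: (unliftP ord0 i) => [j ->|->].
  by rewrite cons_row_lift; exact: Av.
by rewrite cons_row0.
Qed.

End lebesgue_rV.

Section moments.
Context {R : realType} {n : nat}.
Implicit Types (t : 'rV[R]_n) (T : set 'rV[R]_n).
Implicit Types (i j : {ffun 'I_n -> nat}) (I : {fset {ffun 'I_n -> nat}}).

(* The library's norm on 'rV[R]_n is the sup norm. *)
Definition euclidean_norm t : R := Num.sqrt (\sum_(k < n) t ord0 k ^+ 2).

Definition monomial i t : R := \prod_(k < n) t ord0 k ^+ i k.

Definition regular_set T :=
  T !=set0 /\
  forall t, T t -> forall e : R, 0 < e ->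
    (0 < lebesgue_rV n [set x | T x /\ (euclidean_norm (x - t) < e)%R])%E.

Definition sigma_index i : set {ffun 'I_n -> nat} :=
  [set j | forall k, j k = 0%N \/ j k = i k].

Definition regular_index I :=
  I != fset0 /\ forall i, i \in I -> sigma_index i `<=` [set j | j \in I].

(* Elements of L^1(T, dt) are represented by functions on R^n, Borel measurable
   on T, whose values outside T play no role. *)
Definition L1_nonneg T (f : 'rV[R]_n -> R) :=
  (lebesgue_rV n).-integrable T (EFin \o f) /\
  {ae lebesgue_rV n, forall t, T t -> 0 <= f t}.

(* A Borel measure on the closed set T is represented by its extension by zero
   to R^n. R^I is I -> R with the product topology. *)
Definition Gamma_TI T I : set {ptws I -> R} :=
  [set g | exists nu : {measure set 'rV[R]_n -> \bar R},
    nu (~` T) = 0%E /\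
    forall i : I,
      (\int[nu]_(t in T) `|monomial (val i) t|%:E < +oo)%E /\
      (\int[nu]_(t in T) (monomial (val i) t)%:E = (g i)%:E)%E].

Definition G_TI T I : set {ptws I -> R} :=
  [set g | g <> (fun=> 0) /\
    exists f : 'rV[R]_n -> R,
      L1_nonneg T f /\
      forall i : I,
        (\int[lebesgue_rV n]_(t in T) (`|monomial (val i) t| * f t)%:E < +oo)%E /\
        (\int[lebesgue_rV n]_(t in T) (monomial (val i) t * f t)%:E = (g i)%:E)%E].

End moments.

Arguments Gamma_TI {R n} T I _.
Arguments G_TI {R n} T I _.

Definition dense_in (X : topologicalType) (A B : set X) :=
  A `<=` B /\ B `<=` closure A.

(* Main.v *)
Require Import Defs.
From HB Require Import structures.
From mathcomp Require Import all_boot all_order all_algebra finmap.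
From mathcomp Require Import all_classical all_reals all_analysis.
From mathcomp Require Import measurable_realfun ring lra.

(** Write m(t) for the vector of monomials (t^i), i in I, so that Gamma is the
set of all integrals of m against measures on T and G the set of nonzero
integrals of m against densities on T. Both are stable under sums and positive
scalings: 0 is in I because I is regular, and the entry at 0 of a point of G is
the total mass of its density, which is positive, so that a sum of two points
of G cannot vanish. Three facts give the theorem.

- G is open ([G_TI_open]). If f is a density of g, replace it by f (1 + u) with
  u = sum_j c_j t^j / W(t), where W(t) = 1 + sum_i |t^i| makes u bounded. This
  moves g by M c, with the Gram matrix M_ij = int t^i t^j f / W, and c . M c is
  the integral of p^2 f / W for p = sum_i c_i t^i. A nonzero polynomial vanishes
  on a null set only ([null_polynomial]), so M is invertible, every small
  displacement of g is some M c with c small, and then f (1 + u) >= 0.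

- G is contained in Gamma, because f dt is a measure ([moment_density_Gamma]).

- Gamma is contained in the closure of G ([Gamma_sub_closure]). By duality for
  cones ([cone_duality]) it suffices that every w with w . g <= 0 on G satisfies
  w . x <= 0 on Gamma. Such a w defines a polynomial q = w . m. If q were
  positive at a point of T, it would be positive near it, and the indicator of a
  small piece of T, which has positive measure since T is regular, would be a
  density whose moments g satisfy w . g > 0 ([G_TI_local]). Hence q <= 0 on T,
  and w . x, the integral of q against a measure on T, is nonpositive.

The first two facts put G inside the interior of Gamma, the last one says that G
is dense. Finally an open convex set contains the interior of its closure: a
point x interior to Gamma is a convex combination of a point of G and of a point
of Gamma slightly beyond x, and the latter may be moved into G while the former
absorbs the change without leaving the open set G ([interior_Gamma_sub]). *)

Set Implicit Arguments.
Unset Strict Implicit.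
Unset Printing Implicit Defensive.

Import Order.TTheory GRing.Theory Num.Theory.
Import numFieldNormedType.Exports.

Local Open Scope classical_set_scope.
Local Open Scope ring_scope.

(** * Zero sets of polynomials *)

Section null_polynomial.
Context {R : realType}.

Lemma measurable_continuous_rV n (f : 'rV[R]_n -> R) :
  continuous f -> measurable_fun [set: 'rV[R]_n] f.
Proof.
move=> cf; apply: (measurability _ (RGenOpens.measurableE R)).
move=> _ [_ [a [b ->] <-]]; rewrite setTI; apply: sub_sigma_algebra.
by apply: open_comp; [move=> x _; exact: cf|exact: interval_open].
Qed.

Lemma continuous_monomial n (i : {ffun 'I_n -> nat}) :
  continuous (monomial i : 'rV[R]_n -> R).
Proof.
apply: continuous_big => [|k _ t]; first exact: mul_continuous.
apply: (@continuous_comp _ _ _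
  (fun t : 'rV[R]_n => t ord0 k) (fun x => x ^+ i k)).
  exact: coord_continuous.
exact: exprn_continuous.
Qed.

Lemma measurable_monomial n (i : {ffun 'I_n -> nat}) :
  measurable_fun [set: 'rV[R]_n] (monomial i).
Proof. by apply: measurable_continuous_rV; exact: continuous_monomial. Qed.

Definition tail_index n (i : {ffun 'I_n.+1 -> nat}) : {ffun 'I_n -> nat} :=
  [ffun k => i (lift ord0 k)].

Definition cons_index n k (i : {ffun 'I_n -> nat}) : {ffun 'I_n.+1 -> nat} :=
  [ffun l => if unlift ord0 l is Some m then i m else k].

Lemma tail_indexK n (i : {ffun 'I_n.+1 -> nat}) :
  cons_index (i ord0) (tail_index i) = i.
Proof.
by apply/ffunP => l; rewrite ffunE; case: unliftP => [m ->|->]; rewrite ?ffunE.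
Qed.

Lemma monomial_cons_row n (i : {ffun 'I_n.+1 -> nat}) (p : R * 'rV[R]_n) :
  monomial i (cons_row p) = p.1 ^+ i ord0 * monomial (tail_index i) p.2.
Proof.
rewrite /monomial big_ord_recl cons_row0; congr (_ * _).
by apply: eq_bigr => k _; rewrite cons_row_lift ffunE.
Qed.

Lemma finite_roots (p : {poly R}) : p != 0 -> finite_set [set a | root p a].
Proof.
move=> p0; apply: contrapT => /(infinite_set_fset (size p))[B Bp].
rewrite leqNgt => /negP; apply; apply: max_poly_roots p0 _ (fset_uniq B).
by apply/allP => a aB; exact: Bp.
Qed.

(** Induction on the dimension, slicing along the first coordinate. Group the
terms by their exponent in the first variable: for the exponent k of the j-th
term, the coefficient q(v) is a polynomial in the other variables that is not
identically zero, hence q(v) != 0 for almost every v by induction, and for such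
v the slice of the zero set is contained in the roots of a nonzero polynomial in
one variable. *)
Lemma null_polynomial n (s : seq {ffun 'I_n -> nat})
    (c : {ffun 'I_n -> nat} -> R) j : uniq s -> j \in s -> c j != 0 ->
  lebesgue_rV n [set t | \sum_(i <- s) c i * monomial i t = 0] = 0%E.
Proof.
elim: n s c j => [|n IH] s c j us js cj.
  (* In dimension 0 there is a single exponent and a single point. *)
  have ji i : i = j by apply/ffunP; case.
  rewrite /= diracE memNset// => /eqP.
  rewrite (bigD1_seq j)//= big1 => [|i]; last by rewrite (ji i) eqxx.
  by rewrite addr0 /monomial big_ord0 mulr1 (negbTE cj).
pose k : nat := j ord0.
pose q v := \sum_(i <- s | i ord0 == k) c i * monomial (tail_index i) v.
have q0 : lebesgue_rV n [set v | q v = 0] = 0%E.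
  pose s' := [seq tail_index i | i : {ffun 'I_n.+1 -> nat} <- s & i ord0 == k].
  rewrite -[RHS](IH s' (fun i => c (cons_index k i)) (tail_index j)).
  - congr (lebesgue_rV n _); apply/seteqP.
    have qE v : \sum_(i <- s') c (cons_index k i) * monomial i v = q v.
      rewrite big_map big_filter; apply: eq_bigr => i /eqP ik.
      by rewrite -ik tail_indexK.
    by split=> v /=; rewrite qE.
  - rewrite map_inj_in_uniq ?filter_uniq// => i i'.
    rewrite !mem_filter => /andP[/eqP ik _] /andP[/eqP i'k _] ii'.
    by rewrite -(tail_indexK i) -(tail_indexK i') ii' ik i'k.
  - by apply: map_f; rewrite mem_filter js eqxx.
  - by rewrite tail_indexK.
rewrite /= /lebesgue_cons /pushforward /product_measure2.
pose Z := [set t : 'rV[R]_n.+1 | \sum_(i <- s) c i * monomial i t = 0].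
have mpoly m (r : seq {ffun 'I_n.+1 -> nat}) P e (b : _ -> R) :
    measurable [set t : 'rV[R]_m |
      \sum_(i <- r | P i) b i * monomial (e i : {ffun 'I_m -> nat}) t = 0].
  rewrite -[X in measurable X]setTI.
  suff mf : measurable_fun [set: 'rV[R]_m] (fun t => \sum_(i <- r | P i)
      b i * monomial (e i : {ffun 'I_m -> nat}) t).
    exact: (mf measurableT _ (measurable_set1 0)).
  under eq_fun do rewrite big_mkcond.
  apply: measurable_sum => i; case: (P i) => //.
  by apply: measurable_funM => //; exact: measurable_monomial.
have mZ : measurable Z by exact: (mpoly _ s xpredT id c).
have mcZ : measurable (@cons_row R n @^-1` Z).
  by rewrite -[X in measurable X]setTI; exact: measurable_cons_row.
transitivity (\int[lebesgue_rV n]_(v in setT) (cst 0 v : \bar R))%E; last first.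
  by rewrite integral0.
apply: ae_eq_integral => //.
  exact: (measurable_fun_ysection (@lebesgue_measure R) mcZ).
exists [set v | q v = 0]; split => //; first exact: mpoly.
move=> v /= /not_implyP[_]; apply: contra_notP => qv.
(* The restriction of the polynomial to the line over v. *)
pose p : {poly R} :=
  \sum_(i <- s) (c i * monomial (tail_index i) v) *: 'X^(i ord0).
have p0 : p != 0.
  apply/eqP => /(congr1 (fun p : {poly R} => p`_k)); rewrite coef0.
  rewrite coef_sum => pk; apply: qv; rewrite -[RHS]pk /q big_mkcond.
  apply: eq_bigr => i _; rewrite coefZ coefXn eq_sym.
  by case: ifP; rewrite ?mulr1 ?mulr0.
apply: countable_lebesgue_measure0; apply: finite_set_countable.
apply: sub_finite_set (finite_roots p0) => a /=.
rewrite /ysection/= inE /Z /= rootE /p horner_sum => Za.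
apply/eqP; rewrite -[RHS]Za; apply: eq_bigr => i _.
rewrite monomial_cons_row hornerZ hornerXn/=; ring.
Qed.

End null_polynomial.

(** * Measures with a density *)

Section density_measure.
Local Open Scope ereal_scope.
Context d (X : measurableType d) {R : realType}.
Variable mu : {measure set X -> \bar R}.

(** The proofs on f are arguments of the definition so that its measure structure
can be inferred from the term. *)
Definition density_measure (f : X -> R) of (forall x, (0 <= f x)%R)
  & measurable_fun [set: X] f := fun A : set X => \int[mu]_(x in A) (f x)%:E.

Variable f : X -> R.
Hypothesis f0 : forall x, (0 <= f x)%R.
Hypothesis mf : measurable_fun [set: X] f.
Local Notation nu := (density_measure f0 mf).

Let density0 : nu set0 = 0.
Proof. exact: integral_set0. Qed.

Let density_ge0 A : 0 <= nu A.
Proof. by apply: integral_ge0 => x _; rewrite lee_fin. Qed.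

Let density_sigma_additive : semi_sigma_additive nu.
Proof.
move=> F mF tF mUF; rewrite /density_measure ge0_integral_bigcup//.
- apply: is_cvg_ereal_nneg_natsum_cond => n _ _.
  by apply: integral_ge0 => x _; rewrite lee_fin.
- exact/measurable_EFinP/measurable_funTS.
- by move=> x _; rewrite lee_fin.
Qed.

HB.instance Definition _ := isMeasure.Build _ _ _ nu
  density0 density_ge0 density_sigma_additive.

Import HBNNSimple.

(** Monotone approximation of h by simple functions: on an indicator, both sides
are the integral of f over a measurable set. *)
Lemma ge0_integral_density (D : set X) (h : X -> \bar R) : measurable D ->
  measurable_fun D h -> (forall x, 0 <= h x) ->
  \int[nu]_(x in D) h x = \int[mu]_(x in D) (h x * (f x)%:E).
Proof.
move=> mD mh h0; pose g := nnsfun_approx mD mh.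
have mgf n : measurable_fun D (fun x => (g n x)%:E * (f x)%:E).
  by apply: emeasurable_funM; exact/measurable_EFinP/measurable_funTS.
transitivity (\int[nu]_(x in D)
    lim ((g n x)%:E @[n --> \oo])).
  apply: eq_integral => x /set_mem Dx; apply/esym/cvg_lim => //.
  exact: cvg_nnsfun_approx.
rewrite monotone_convergence//; last 3 first.
- by move=> n; exact/measurable_EFinP/measurable_funTS.
- by move=> n x _; rewrite lee_fin.
- by move=> x _ a b ab; rewrite lee_fin; exact/lefP/nd_nnsfun_approx.
transitivity (\int[mu]_(x in D) lim ((g n x)%:E * (f x)%:E @[n --> \oo])).
  rewrite monotone_convergence//; last 2 first.
  - by move=> n x _; rewrite mule_ge0 ?lee_fin.
  - move=> x _ a b ab; rewrite lee_wpmul2r ?lee_fin//.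
    exact/lefP/nd_nnsfun_approx.
  congr (limn _); apply/funext => n.
  transitivity (\int[nu]_(x in D) (\sum_(y \in range (g n))
      (y * \1_(g n @^-1` [set y]) x)%:E)).
    by apply: eq_integral => x _; rewrite /= fimfunE -fsumEFin.
  have mI r : measurable_fun D (fun x => (r * \1_(g n @^-1` [set r]) x)%:E).
    by apply: measurable_funTS; exact/measurable_EFinP/measurable_funM.
  rewrite ge0_integral_fsum//; last first.
    by move=> r x _; exact: nnfun_muleindic_ge0.
  transitivity (\int[mu]_(x in D) (\sum_(y \in range (g n))
      (y * \1_(g n @^-1` [set y]) x)%:E * (f x)%:E)); last first.
    apply: eq_integral => x _.
    rewrite -ge0_mule_fsuml => [|y]; last exact: nnfun_muleindic_ge0.
    by rewrite fsumEFin// -(fimfunE _ x).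
  rewrite ge0_integral_fsum//; last 2 first.
  - move=> r; apply: emeasurable_funM => //.
    exact/measurable_EFinP/measurable_funTS.
  - by move=> r x _; rewrite mule_ge0 ?nnfun_muleindic_ge0 ?lee_fin.
  apply: eq_fsbigr => r /set_mem[t _ rE].
  have r0 : (0 <= r)%R by rewrite -rE.
  have mfD : measurable_fun D (EFin \o f).
    exact/measurable_EFinP/measurable_funTS.
  (* Both sides are now integrals of r times the indicator of a level set. *)
  under [RHS]eq_integral do rewrite EFinM -muleA.
  rewrite ge0_integralZl//; last 2 first.
  - by apply: emeasurable_funM => //; exact/measurable_EFinP.
  - by move=> x _; rewrite mule_ge0// lee_fin.
  rewrite integralZl_indic_nnsfun// integral_indic//; congr (_ * _).
  under [RHS]eq_integral do rewrite muleC.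
  rewrite (eq_integral ((EFin \o f) \_ (g n @^-1` [set r]))); last first.
    by move=> x xD; rewrite epatch_indic.
  by rewrite -integral_mkcondr setIC.
apply: eq_integral => x /set_mem Dx; apply/cvg_lim => //; apply: cvgeZr => //.
exact: cvg_nnsfun_approx.
Qed.

Lemma integral_density (D : set X) (h : X -> R) : measurable D ->
    measurable_fun D h ->
  \int[nu]_(x in D) (h x)%:E = \int[mu]_(x in D) (h x * f x)%:E.
Proof.
move=> mD mh; rewrite [LHS]integralE [RHS]integralE.
have mEh : measurable_fun D (EFin \o h) by exact/measurable_EFinP.
rewrite !ge0_integral_density//;
  [|exact: measurable_funeneg|exact: measurable_funepos].
by congr (_ - _); apply: eq_integral => x _; rewrite ?funeposE ?funenegE/=;
  rewrite -?EFinN -!EFin_max -EFinM maxr_pMl// mul0r// mulNr.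
Qed.

End density_measure.

(** * Duality for convex cones *)

Section cones.
Context {R : realType} {J : finType}.
Implicit Types (K : set {ptws J -> R}) (x w g h : {ptws J -> R}).

(** The index type J carries no topology here, whereas it is a topological space
in the general characterization of pointwise convergence. *)
Lemma ptws_cvgP (F : set_system {ptws J -> R}) x : Filter F ->
  F --> x <-> forall j, (fun h : {ptws J -> R} => h j) @ F --> x j.
Proof.
move=> FF; split=> [Fx j|Fx].
  exact: (cvg_comp _ _ Fx (@proj_continuous J (fun=> R) j x)).
apply/cvg_sup => j; apply/cvg_image.
  by rewrite eqEsubset; split=> v // _; exists (fun=> v).
move=> W /Fx Wj; exists ((fun h : {ptws J -> R} => h j) @^-1` W) => //.
by rewrite eqEsubset; split=> [r [? + <-//]|r Wr]; exists (fun=> r).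
Qed.

Lemma nbhs_ptws_box x (e : R) : 0 < e ->
  \forall h \near x, forall j, `|h j - x j| < e.
Proof.
move=> e0.
apply: (@filter_forall _ J (fun j (h : {ptws J -> R}) => `|h j - x j| < e)
  (nbhs x) (nbhs_filter x)).
move=> j.
have xj : (fun h : {ptws J -> R} => h j) @ nbhs x --> x j.
  exact: (@proj_continuous J (fun=> R) j x).
have sub : ((fun h : {ptws J -> R} => h j) @^-1` ball (x j) e) `<=`
    [set h | `|h j - x j| < e].
  by move=> h /=; rewrite /ball/= distrC.
have xje : nbhs (x j) (ball (x j) e) by exact: nbhsx_ballx.
exact: (@filterS _ (nbhs x) (nbhs_filter x) _ _ sub (xj _ xje)).
Qed.

Definition dot w x : R := \sum_j w j * x j.

Lemma continuous_ptws_sum (f : J -> R -> R) : (forall j, continuous (f j)) ->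
  continuous (fun x : {ptws J -> R} => \sum_j f j (x j)).
Proof.
move=> cf; apply: continuous_big => [|j _ x]; first exact: add_continuous.
apply: (@continuous_comp _ _ _ (fun h : {ptws J -> R} => h j) (f j)).
  exact: (@proj_continuous J (fun=> R) j x).
exact: cf.
Qed.

Lemma closure_ptws_comb K (a s : R) g h :
  (forall k, K k -> K (fun j => a * k j + s * g j)) ->
  closure K h -> closure K (fun j => a * h j + s * g j).
Proof.
move=> Kg Kh B.
pose T (x : {ptws J -> R}) : {ptws J -> R} := fun j => a * x j + s * g j.
have cT : nbhs (T h) `<=` (T @ nbhs h).
  apply: (proj2 (@ptws_cvgP (T @ nbhs h) (T h) _)) => j.
  have cj : (fun x : {ptws J -> R} => x j) @ nbhs h --> h j.
    exact: (@proj_continuous J (fun=> R) j h).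
  exact: (cvgD (cvgM (cvg_cst a) cj) (cvg_cst (s * g j))).
move=> /cT TB; have [k [Kk TBk]] := Kh _ TB.
by exists (T k); split => //; exact: Kg.
Qed.

(** The squared distance to x is continuous, and its points of value at most that
of a given point of K lie in a product of segments, which is compact. *)
Lemma nearest_point K x : K !=set0 ->
  exists2 p, closure K p & forall h, closure K h ->
    \sum_j (x j - p j) ^+ 2 <= \sum_j (x j - h j) ^+ 2.
Proof.
move=> [k0 Kk0]; pose D h := \sum_j (x j - h j) ^+ 2.
(* D k0 + 1 bounds the square root of D k0. *)
pose b : R := D k0 + 1.
pose A : set {ptws J -> R} :=
  [set h | forall j, h j \in `[x j - b, x j + b]%R].
have cA : compact A.
  exact: (@tychonoff J (fun=> R) _
    (fun j => @segment_compact R (x j - b) (x j + b))).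
have D0 h : 0 <= D h by apply: sumr_ge0 => j _; exact: sqr_ge0.
have DA h : D h <= D k0 -> A h.
  move=> Dh j /=.
  have : (x j - h j) ^+ 2 <= D k0.
    apply: le_trans Dh; rewrite /D (bigD1 j)//= lerDl.
    by apply: sumr_ge0 => i _; exact: sqr_ge0.
  rewrite in_itv/= /b => hj.
  have := D0 k0; set e := D k0 in hj *; move=> e0.
  by apply/andP; split; nra.
have cD : continuous D.
  apply: (@continuous_ptws_sum (fun j r => (x j - r) ^+ 2)) => j r.
  apply: (@continuous_comp _ _ _ (fun r => x j - r) (fun r => r ^+ 2)).
    by apply: cvgB; [exact: cvg_cst|exact: cvg_id].
  exact: exprn_continuous.
have [|||p] := @compact_EVT_min _ _ D (closure K `&` A).
- by exists k0; split; [exact: subset_closure|exact: DA].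
- by rewrite setIC; apply: compact_closedI => //; exact: closed_closure.
- exact: continuous_subspaceT.
rewrite inE => -[Kp Ap] pmin; exists p => // h Kh.
have [hk|kh] := leP (D h) (D k0).
  by apply: pmin; rewrite inE; split => //; exact: DA.
apply: le_trans (ltW kh); apply: pmin; rewrite inE; split.
  exact: subset_closure.
exact: DA.
Qed.

(** The quadratic term is negligible against the linear one as s tends to 0. *)
Lemma linear_coef_ge0 (a b : R) :
  (forall s, 0 < s -> s < 1 -> 0 <= s * a + s ^+ 2 * b) -> 0 <= a.
Proof.
move=> ab; rewrite leNgt; apply/negP => a0.
pose s := - a / (`|b| - a + - a).
have b0 := normr_ge0 b; have bb := ler_norm b.
have den0 : 0 < `|b| - a + - a by lra.
have s0 : 0 < s by rewrite divr_gt0; lra.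
have s1 : s < 1 by rewrite ltr_pdivrMr; lra.
have sE : s * (`|b| - a + - a) = - a by rewrite divfK// gt_eqF.
have := ab s s0 s1; rewrite expr2 -mulrA -mulrDr pmulr_rge0//.
nra.
Qed.

(** Let p be the point of closure K nearest to x and w = x - p. Moving p inside
closure K does not bring it closer to x, so w has a nonpositive product with
every direction u that stays in closure K. The points of K are such directions,
and so is - p, because p may be shrunk towards 0. By the hypothesis on K the
former gives w . x <= 0, the latter gives w . p >= 0, hence
|w|^2 = w . x - w . p <= 0 and x = p. *)
Lemma cone_duality K x : K !=set0 ->
  (forall g h, K g -> K h -> K (fun j => g j + h j)) ->
  (forall (s : R) g, 0 < s -> K g -> K (fun j => s * g j)) ->
  (forall w, (forall k, K k -> dot w k <= 0) -> dot w x <= 0) ->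
  closure K x.
Proof.
move=> K0 KD KZ Kx; have [p Kp pmin] := nearest_point x K0.
pose w : {ptws J -> R} := fun j => x j - p j.
pose N (u : {ptws J -> R}) := \sum_j u j ^+ 2.
have expand (u : {ptws J -> R}) s :
    N (fun j => w j - s * u j) = N w - 2 * s * dot w u + s ^+ 2 * N u.
  rewrite /N /dot mulr_sumr [s ^+ 2 * _]mulr_sumr -sumrB -big_split/=.
  by apply: eq_bigr => j _; ring.
have dir (u : {ptws J -> R}) :
    (forall s, 0 < s -> s < 1 -> closure K (fun j => p j + s * u j)) ->
    dot w u <= 0.
  move=> Ku; rewrite -oppr_ge0 -(pmulr_rge0 _ (ltr0Sn R 1)).
  apply: (@linear_coef_ge0 _ (N u)) => s s0 s1.
  have := pmin _ (Ku s s0 s1).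
  have -> : \sum_j (x j - (p j + s * u j)) ^+ 2 = N (fun j => w j - s * u j).
    by apply: eq_bigr => j _; rewrite /w; ring.
  rewrite expand -/(N w); set a := N w; set b := dot w u; set c := N u.
  by move=> H; rewrite -(lerD2l a) addr0; apply: le_trans H _; lra.
have wK k : K k -> dot w k <= 0.
  move=> Kk; apply: dir => s s0 _.
  have := @closure_ptws_comb K 1 s k p.
  under [X in _ -> _ -> closure _ X]eq_fun do rewrite mul1r.
  apply => // h Kh; under eq_fun do rewrite mul1r.
  by apply: KD => //; exact: KZ.
have wp : dot w (fun j => - p j) <= 0.
  apply: dir => s s0 s1.
  have := @closure_ptws_comb K (1 - s) 0 p p.
  rewrite (_ : (fun j => _) = (fun j => p j + s * - p j)); last first.
    by apply/funext => j; ring.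
  apply => // h Kh; under eq_fun do rewrite mul0r addr0.
  by apply: KZ => //; lra.
have Nw0 : N w <= 0.
  have := Kx w wK; suff -> : dot w x = N w - dot w (fun j => - p j) by lra.
  by rewrite /dot /N -sumrB; apply: eq_bigr => j _; rewrite /w; ring.
have w0 j : w j = 0.
  apply/eqP; rewrite -sqrf_eq0 eq_le sqr_ge0 andbT.
  apply: le_trans Nw0; rewrite /N (bigD1 j)//= lerDl.
  by apply: sumr_ge0 => i _; exact: sqr_ge0.
suff -> : x = p by [].
by apply/funext => j; apply/eqP; rewrite -subr_eq0; exact/eqP/w0.
Qed.

End cones.

(** * Linear systems and linear combinations of integrals *)

(** The system is solvable because M has trivial kernel; the bound on the
solution, with the sum of the entries of the inverse in absolute value as
constant, is the continuity of the inverse. *)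
Lemma definite_solvable (R : realFieldType) (J : finType) (M : J -> J -> R) :
  (forall c : J -> R, \sum_i c i * (\sum_j M i j * c j) = 0 ->
    forall i, c i = 0) ->
  exists2 C : R, 0 <= C & forall h : J -> R, exists2 c : J -> R,
    forall i, \sum_j M i j * c j = h i & forall j, `|c j| <= C * \sum_i `|h i|.
Proof.
move=> Mdef; pose N := #|J|.
pose A : 'M[R]_N := \matrix_(i, j) M (enum_val i) (enum_val j).
have mulA (c : J -> R) i :
    \sum_j M i j * c j = (A *m \col_k c (enum_val k)) (enum_rank i) ord0.
  rewrite mxE (reindex (@enum_val J J))/=; last exact/onW_bij/enum_val_bij.
  by apply: eq_bigr => k _; rewrite !mxE enum_rankK.
have uA : A \in unitmx.
  rewrite -unitmx_tr -row_free_unit -kermx_eq0; apply/rowV0P => v /sub_kermxP vA.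
  have {}vA : A *m v^T = 0 by rewrite -[A]trmxK -trmx_mul vA trmx0.
  pose c i := v ord0 (enum_rank i).
  have cE : \col_k c (enum_val k) = v^T.
    by apply/colP => k; rewrite !mxE /c enum_valK.
  apply/rowP => k; rewrite mxE.
  have := Mdef c; rewrite big1 => [/(_ erefl (enum_val k))|i _].
    by rewrite /c enum_valK.
  by rewrite mulA cE vA mxE mulr0.
exists (\sum_i \sum_j `|invmx A i j|).
  by apply: sumr_ge0 => i _; apply: sumr_ge0.
move=> h; pose v := invmx A *m \col_k h (enum_val k).
exists (fun j => v (enum_rank j) ord0) => [i|j].
  rewrite mulA (_ : \col_k _ = v).
    by rewrite mulKVmx// mxE enum_rankK.
  by apply/colP => k; rewrite mxE enum_valK.
rewrite mxE; apply: le_trans (ler_norm_sum _ _ _) _.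
apply: (@le_trans _ _ ((\sum_k `|invmx A (enum_rank j) k|) * \sum_i `|h i|)).
  rewrite mulr_suml; apply: ler_sum => k _.
  rewrite normrM mxE; apply: ler_wpM2l => //.
  by rewrite (bigD1 (enum_val k))//= lerDl sumr_ge0.
apply: ler_wpM2r; first exact: sumr_ge0.
rewrite [leRHS](bigD1 (enum_rank j))//= lerDl.
by apply: sumr_ge0 => i _; apply: sumr_ge0.
Qed.

Section integral_combination.
Context d (X : measurableType d) {R : realType}.
Variables (mu : {measure set X -> \bar R}) (D : set X) (mD : measurable D).

Lemma integral_combination (J : finType) (h : J -> X -> R) (w g : J -> R) :
  (forall j, mu.-integrable D (EFin \o h j)) ->
  (forall j, (\int[mu]_(x in D) (h j x)%:E)%E = (g j)%:E) ->
  mu.-integrable D (fun x => (\sum_j w j * h j x)%:E) /\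
  (\int[mu]_(x in D) (\sum_j w j * h j x)%:E)%E = (\sum_j w j * g j)%:E.
Proof.
move=> ih hg.
have iwh j : mu.-integrable D (fun x => (w j)%:E * (h j x)%:E)%E.
  by have := integrableZl mD (w j) (ih j).
have E x : (\sum_j w j * h j x)%:E = (\sum_j (w j)%:E * (h j x)%:E)%E.
  by rewrite -sumEFin.
split.
  by under eq_fun do rewrite E; apply: integrable_sum.
under eq_integral do rewrite E.
rewrite integral_sum// -sumEFin; apply: eq_bigr => j _.
by rewrite (integralZl mD (ih j)) hg.
Qed.

End integral_combination.

(** * Moments of densities *)

Section moments.
Context {R : realType} {n : nat}.
Variables (T : set 'rV[R]_n) (I : {fset {ffun 'I_n -> nat}}).
Notation lambda := (lebesgue_rV n).

(** Almost everywhere conditions are replaced by conditions at every point, which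
makes sums, scalings and products of densities easy to form; [G_TIP] shows
that this represents the same moments. *)
Definition moment_density (f : 'rV[R]_n -> R) (g : {ptws I -> R}) :=
  [/\ measurable_fun [set: 'rV[R]_n] f, forall t, 0 <= f t &
    forall i : I,
      lambda.-integrable T (fun t => (monomial (val i) t * f t)%:E) /\
      (\int[lambda]_(t in T) (monomial (val i) t * f t)%:E)%E = (g i)%:E].

Hypothesis mT : measurable T.

Let mmono (i : I) : measurable_fun T (monomial (val i) : 'rV[R]_n -> R).
Proof. by apply: measurable_funTS; exact: measurable_monomial. Qed.

(** The density is cut off outside T, since the measure must vanish there. *)
Lemma moment_density_Gamma f g : moment_density f g -> Gamma_TI T I g.
Proof.
move=> [mf f0 fg].
pose f' := f \_ T.
have f'0 t : 0 <= f' t by rewrite /f' patchE; case: ifP.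
have mf' : measurable_fun setT f'.
  by apply: (iffLR (measurable_restrictT _ mT)); exact: measurable_funTS.
have f'E t : t \in T -> f' t = f t by move=> tT; rewrite /f' patchE tT.
exists (density_measure lambda f'0 mf'); split.
  apply: integral0_eq => t /= nTt.
  by rewrite /f' patchE memNset.
move=> i; have [fi fi2] := fg i; split.
  rewrite integral_density//; last exact: measurableT_comp.
  have /integrableP[_] := fi; congr (_ < _)%E; apply: eq_integral => t tT /=.
  by rewrite normrM (ger0_norm (f0 t)) f'E.
rewrite integral_density//.
by rewrite -fi2; apply: eq_integral => t tT; rewrite f'E.
Qed.

(* The zero exponent, whose moment is the total mass. *)
Variable o : I.
Hypothesis o0 : forall k, val o k = 0%N.

Lemma monomial_o (t : 'rV[R]_n) : monomial (val o) t = 1.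
Proof. by rewrite /monomial big1// => k _; rewrite o0 expr0. Qed.

(** A density that is nonnegative almost everywhere on T is replaced by its
positive part, extended by 0 outside T. *)
Lemma G_TIP g : G_TI T I g <->
  g <> (fun=> 0) /\ exists f, moment_density f g.
Proof.
split=> -[g0 [f Hf]]; split=> //.
  move: Hf => [[fi f0] fg].
  have mf : measurable_fun T f by exact/measurable_EFinP/measurable_int/fi.
  pose h := (fun t => Num.max (f t) 0) \_ T.
  have h0 t : 0 <= h t.
    by rewrite /h patchE; case: ifP => // _; rewrite le_max lexx orbT.
  have mh : measurable_fun setT h.
    apply: (iffLR (measurable_restrictT _ mT)).
    exact: measurable_maxr mf (measurable_cst (0 : R)).
  have aefh : {ae lambda, forall t, T t -> f t = h t}.
    apply: filterS f0 => t f0 Tt; rewrite /h patchE mem_set//.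
    by rewrite max_l// f0.
  exists h; split => // i; have [fi1 fi2] := fg i.
  have mih : measurable_fun T (fun t => (monomial (val i) t * h t)%:E).
    by apply/measurable_EFinP/measurable_funM => //; exact/measurable_funTS.
  split.
    apply/integrableP; split => //.
    apply: le_lt_trans fi1; rewrite le_eqVlt; apply/orP; left; apply/eqP.
    apply: ae_eq_integral => //.
    - exact: measurableT_comp.
    - by apply/measurable_EFinP/measurable_funM => //; exact: measurableT_comp.
    - apply: filterS aefh => t fh Tt; rewrite fh//= normrM.
      by rewrite (ger0_norm (h0 t)).
  rewrite -fi2; apply: ae_eq_integral => //.
  - by apply/measurable_EFinP/measurable_funM.
  - by apply: filterS aefh => t fh Tt; rewrite fh.
move: Hf => [mf f0 fg]; exists f; split.
  split; last by apply: aeW => t _.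
  have [] := fg o; under eq_fun do rewrite monomial_o mul1r.
  by [].
move=> i; have [fi fi2] := fg i; split => //.
have /integrableP[_] := fi.
by under eq_integral do rewrite /= normrM (ger0_norm (f0 _)).
Qed.

Lemma moment_ae0 f g : moment_density f g ->
  ae_eq lambda T (EFin \o f) (cst 0%E) -> g = (fun=> 0).
Proof.
move=> [mf f0 fg] fae; apply/funext => i; have [_ fi] := fg i.
suff : (g i)%:E = 0%E by move=> [].
rewrite -fi -(integral0 lambda T); apply: ae_eq_integral => //.
  by apply/measurable_EFinP/measurable_funM => //; exact/measurable_funTS.
by apply: filterS fae => t ft0 Tt; move: (ft0 Tt) => /= [->]; rewrite mulr0.
Qed.

(** A nonnegative density of total mass 0 vanishes almost everywhere, and then all
its moments are 0. *)
Lemma moment_o_gt0 f g : moment_density f g -> g <> (fun=> 0) -> 0 < g o.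
Proof.
move=> fg g0; have [mf f0 /(_ o)[_ fo]] := fg.
have foE : (\int[lambda]_(t in T) (f t)%:E)%E = (g o)%:E.
  by rewrite -fo; apply: eq_integral => t _; rewrite monomial_o mul1r.
rewrite lt_neqAle -lee_fin -foE integral_ge0 ?andbT => [|t _]; last first.
  by rewrite lee_fin.
apply/eqP => go0; apply: g0; apply: (moment_ae0 fg).
apply/ae_eq_integral_abs => //; first exact/measurable_EFinP/measurable_funTS.
under eq_integral => t _ do rewrite /= (ger0_norm (f0 t)).
by rewrite foE -go0.
Qed.

Lemma moment_densityD f g f' g' :
  moment_density f g -> moment_density f' g' ->
  moment_density (f \+ f') (fun i => g i + g' i).
Proof.
move=> [mf f0 fg] [mf' f0' fg']; split.
- exact: measurable_funD.
- by move=> t; rewrite addr_ge0.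
- move=> i; have [fi fi2] := fg i; have [fi' fi2'] := fg' i.
  have E t : (monomial (val i) t * (f \+ f') t)%:E =
      ((monomial (val i) t * f t)%:E + (monomial (val i) t * f' t)%:E)%E.
    by rewrite /= mulrDr.
  split; first by under eq_fun do rewrite E; exact: integrableD.
  under eq_integral do rewrite E.
  by rewrite (integralD mT fi fi') fi2 fi2'.
Qed.

Lemma moment_densityZ (s : R) f g : 0 <= s -> moment_density f g ->
  moment_density (fun t => s * f t) (fun i => s * g i).
Proof.
move=> s0 [mf f0 fg]; split.
- exact: measurable_funM.
- by move=> t; rewrite mulr_ge0.
- move=> i; have [fi fi2] := fg i.
  have E t : (monomial (val i) t * (s * f t))%:E =
      (s%:E * (monomial (val i) t * f t)%:E)%E.
    by rewrite -EFinM mulrCA.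
  split; first by under eq_fun do rewrite E; have := integrableZl mT s fi.
  under eq_integral do rewrite E.
  by rewrite (integralZl mT fi) fi2.
Qed.

Lemma G_TID g g' : G_TI T I g -> G_TI T I g' -> G_TI T I (fun i => g i + g' i).
Proof.
move=> /G_TIP[g0 [f fg]] /G_TIP[g0' [f' fg']]; apply/G_TIP; split.
  move=> /(congr1 (fun u => u o)); apply/eqP; rewrite gt_eqF//.
  by rewrite addr_gt0 ?(moment_o_gt0 fg) ?(moment_o_gt0 fg').
by exists (f \+ f'); exact: moment_densityD.
Qed.

Lemma G_TIZ (s : R) g : 0 < s -> G_TI T I g -> G_TI T I (fun i => s * g i).
Proof.
move=> s0 /G_TIP[g0 [f fg]]; apply/G_TIP; split.
  move=> /(congr1 (fun u => u o)); apply/eqP; rewrite gt_eqF//.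
  by rewrite mulr_gt0 ?(moment_o_gt0 fg).
by exists (fun t => s * f t); apply: moment_densityZ => //; exact: ltW.
Qed.

End moments.

(** * Densities concentrated near a point *)

Section euclid.
Context {R : realType} {n : nat}.
Implicit Types (t x : 'rV[R]_n).

Lemma coord_le_euclidean t k : `|t ord0 k| <= euclidean_norm t.
Proof.
rewrite -sqrtr_sqr ler_wsqrtr// (bigD1 k)//= lerDl.
by apply: sumr_ge0 => i _; exact: sqr_ge0.
Qed.

Lemma measurable_euclidean_ball t (e : R) :
  measurable [set x | euclidean_norm (x - t) < e].
Proof.
apply: sub_sigma_algebra.
have -> : [set x | euclidean_norm (x - t) < e] =
    (fun x => euclidean_norm (x - t)) @^-1` [set r | r < e] by [].
apply: open_comp; last exact: open_lt.
move=> x _; rewrite /euclidean_norm.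
apply: (@continuous_comp _ _ _
  (fun x : 'rV[R]_n => \sum_(k < n) (x - t) ord0 k ^+ 2) Num.sqrt).
  move: x; apply: continuous_big => [|k _ x]; first exact: add_continuous.
  apply: (@continuous_comp _ _ _
    (fun x : 'rV[R]_n => (x - t) ord0 k) (fun r => r ^+ 2)).
    rewrite (_ : (fun _ => _) = (fun x : 'rV[R]_n => x ord0 k - t ord0 k)).
      have /= ck := @coord_continuous R 1 n ord0 k x.
      have ct : cst (t ord0 k) @ nbhs x --> t ord0 k by exact: cvg_cst.
      exact: cvgB ck ct.
    by apply/funext => y; rewrite !mxE.
  exact: exprn_continuous.
exact: sqrt_continuous.
Qed.

Lemma euclidean_ball_fin t (e : R) :
  (lebesgue_rV n [set x | (euclidean_norm (x - t) < e)%R] < +oo)%E.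
Proof.
pose A k : set R := `[t ord0 k - e, t ord0 k + e]%classic.
have mA k : measurable (A k) by exact: measurable_itv.
pose B := [set x : 'rV[R]_n | forall k, A k (x ord0 k)].
have mB : measurable B.
  have -> : B = \bigcap_(k in [set: 'I_n])
      (fun x : 'rV[R]_n => x ord0 k) @^-1` A k.
    by apply/seteqP; split=> x /= xA k; [move=> _|]; exact: xA.
  apply: fin_bigcap_measurable => // k _; rewrite -[X in measurable X]setTI.
  exact: measurable_coord.
apply: (@le_lt_trans _ _ (lebesgue_rV n B)).
  apply: le_measure; [apply: mem_set|exact: mem_set|].
    exact: measurable_euclidean_ball.
  move=> x /= xe k; rewrite /A /= in_itv/=.
  have := le_lt_trans (coord_le_euclidean (x - t) k) xe.
  by rewrite !mxE ltr_distl => /andP[/ltW -> /ltW ->].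
rewrite lebesgue_rV_box// ltey_eq; apply/orP; left.
elim/big_ind : _ => // [x y|k _]; first exact: fin_numM.
by rewrite lebesgue_measure_itv; case: ifP.
Qed.

Lemma euclidean_ball_near t (P : set 'rV[R]_n) : (\forall x \near t, P x) ->
  exists2 e : R, 0 < e & forall x, euclidean_norm (x - t) < e -> P x.
Proof.
move=> /nbhs_ballP[e /= e0 eP]; exists e => // x xe; apply: eP.
split => // i k; rewrite ord1 /ball/= distrC.
by have := le_lt_trans (coord_le_euclidean (x - t) k) xe; rewrite !mxE.
Qed.

End euclid.

Section regular_moments.
Context {R : realType} {n : nat}.
Variables (T : set 'rV[R]_n) (I : {fset {ffun 'I_n -> nat}}).
Notation lambda := (lebesgue_rV n).
Hypothesis mT : measurable T.
Variable o : I.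
Hypothesis o0 : forall k, val o k = 0%N.

(** The density is the indicator of the part S of T in a Euclidean ball around t0,
so small that the polynomial with coefficients w is positive and all monomials
are bounded on it; S has positive measure by regularity of T. *)
Lemma G_TI_local (w : {ptws I -> R}) t0 : regular_set T -> T t0 ->
  0 < \sum_(i : I) w i * monomial (val i) t0 ->
  exists2 g, G_TI T I g & 0 < dot w g.
Proof.
move=> [_ regT] Tt0; pose q t := \sum_(i : I) w i * monomial (val i) t.
rewrite -/(q t0) => qt0.
have cq : continuous q.
  apply: continuous_big => [|i _ x]; first exact: add_continuous.
  exact: cvgM (cvg_cst _) (@continuous_monomial R n (val i) x).
pose b i : R := `|monomial (val (i : I)) t0| + 1.
have [e e0 eP] : exists2 e : R, 0 < e & forall x, euclidean_norm (x - t0) < e ->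
    0 < q x /\ forall i : I, `|monomial (val i) x| < b i.
  apply: (@euclidean_ball_near _ _ t0
    [set x | 0 < q x /\ forall i : I, `|monomial (val i) x| < b i]).
  near=> x; split.
    near: x; exact: (cq t0 _ (lt_nbhsr qt0)).
  near: x; apply: filter_forall => i.
  have bi : `|monomial (val i) t0| < b i by rewrite ltrDl.
  exact: (cvg_norm (@continuous_monomial R n (val i) t0) (lt_nbhsl bi)).
pose S := [set x | T x /\ euclidean_norm (x - t0) < e].
have mS : measurable S.
  by apply: measurableI => //; exact: measurable_euclidean_ball.
have Soo : (lambda S < +oo)%E.
  apply: le_lt_trans (euclidean_ball_fin t0 e); apply: le_measure.
  - exact: mem_set.
  - by apply: mem_set; exact: measurable_euclidean_ball.
  - by move=> x [].
pose f : 'rV[R]_n -> R := \1_S.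
have mf : measurable_fun setT f by exact: measurable_indic.
have iS : lambda.-integrable T (EFin \o f).
  apply/integrableP; split; first exact/measurable_EFinP/measurable_funTS.
  under eq_integral => t _ do rewrite /= ger0_norm ?indicE//.
  by rewrite integral_indic//; apply: le_lt_trans Soo; apply: le_measure;
    [apply: mem_set; exact: measurableI|exact: mem_set|exact: subIsetl].
have ii (i : I) :
    lambda.-integrable T (fun t => (monomial (val i) t * f t)%:E).
  apply: (@le_integrable _ _ _ _ _ mT _
    (fun t => ((b i)%:E * (EFin \o f) t)%E)).
  - apply/measurable_EFinP/measurable_funM; apply: measurable_funTS => //.
    exact: measurable_monomial.
  - move=> t Tt; rewrite -EFinM lee_fin /= /f indicE.
    case: (boolP (t \in S)) => [/set_mem[_ /eP[_ /(_ i) /ltW tb]]|_].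
      by rewrite !mulr1 (le_trans tb)// ler_norm.
    by rewrite !mulr0.
  - by have := integrableZl mT (b i) iS.
pose g : {ptws I -> R} :=
  fun i => fine (\int[lambda]_(t in T) (monomial (val i) t * f t)%:E)%E.
have fg : moment_density T f g.
  split => //.
  move=> i; split; first exact: ii.
  by rewrite /g fineK//; exact: integrable_fin_num.
have [_ _ fgi] := fg.
have [_ iqE] := integral_combination mT w ii (fun i => (fgi i).2).
have qfE t : \sum_(i : I) w i * (monomial (val i) t * f t) = q t * f t.
  by rewrite mulr_suml; apply: eq_bigr => i _; rewrite mulrA.
have qf0 t : 0 <= q t * f t.
  rewrite /f indicE.
  case: (boolP (t \in S)) => [/set_mem[_ /eP[/ltW qt0' _]]|_].
    by rewrite mulr1.
  by rewrite mulr0.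
have dE : (\int[lambda]_(t in T) (q t * f t)%:E)%E = (dot w g)%:E.
  by rewrite /dot -iqE; apply: eq_integral => t _; rewrite qfE.
have d0 : 0 < dot w g.
  rewrite lt_neqAle -[X in _ && X]lee_fin -dE integral_ge0 ?andbT; last first.
    by move=> t _; rewrite lee_fin.
  apply/eqP => d0; have := regT t0 Tt0 e e0; rewrite -/S => /gt_eqF/negP; apply.
  apply/eqP.
  have : ae_eq lambda T (EFin \o (fun t => q t * f t)) (cst 0%E).
    apply/ae_eq_integral_abs => //.
      apply/measurable_EFinP/measurable_funM; apply: measurable_funTS => //.
      apply: measurable_sum => i; apply: measurable_funM => //.
      exact: measurable_monomial.
    under eq_integral => t _ do rewrite /= (ger0_norm (qf0 t)).
    by rewrite dE -d0.
  move=> [N [mN N0 SN]]; apply: (subset_measure0 _ _ _ N0) => //.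
  move=> x Sx; apply: SN => /=; apply/not_implyP; split; first by case: Sx.
  rewrite /f indicE mem_set// mulr1 => -[qx0].
  by have [_ /eP[+ _]] := Sx; rewrite qx0 ltxx.
exists g => //; apply/(G_TIP mT o0); split; last by exists f.
by move=> g0; move: d0; rewrite g0 /dot big1 ?ltxx// => i _; rewrite mulr0.
Unshelve. all: by end_near. Qed.

End regular_moments.

(** * Perturbation of a density *)

Section openness.
Context {R : realType} {n : nat}.
Variables (T : set 'rV[R]_n) (I : {fset {ffun 'I_n -> nat}}).
Notation lambda := (lebesgue_rV n).
Hypothesis mT : measurable T.
Variable o : I.
Hypothesis o0 : forall k, val o k = 0%N.

Lemma null_moment_polynomial (c : I -> R) (j : I) : c j != 0 ->
  lambda [set t | \sum_(i : I) c i * monomial (val i) t = 0] = 0%E.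
Proof.
move=> cj.
pose c' (i : {ffun 'I_n -> nat}) : R := if insub i is Some k then c k else 0.
have := @null_polynomial R n (enum_fset I) c' (val j) (fset_uniq I) (valP j).
rewrite /c' valK => /(_ cj) <-; congr (lambda _).
have qE t : \sum_(i : I) c i * monomial (val i) t =
    \sum_(i <- enum_fset I) c' i * monomial i t.
  by rewrite big_seq_fsetE/=; apply: eq_bigr => i _; rewrite /c' valK.
by apply/seteqP; split=> t /=; rewrite qE.
Qed.

(** The functions f b_j, where b_j = t^j / W is bounded by 1, again have finite
moments. Their Gram matrix M is definite, because c . M c is the integral of
p^2 f / W, where p is the polynomial with coefficients c, and f is not almost
everywhere 0. The required u is the combination of the b_j whose coefficients
solve the linear system with matrix M and right-hand side h. *)
Lemma moment_perturbation f (g : {ptws I -> R}) :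
  moment_density T f g -> g <> (fun=> 0) ->
  exists2 C : R, 0 <= C & forall h : I -> R, exists u : 'rV[R]_n -> R,
    [/\ measurable_fun [set: 'rV[R]_n] u,
      forall t, `|u t| <= C * \sum_i `|h i| &
      forall i : I,
        lambda.-integrable T (fun t => (monomial (val i) t * f t * u t)%:E) /\
        (\int[lambda]_(t in T) (monomial (val i) t * f t * u t)%:E)%E =
          (h i)%:E].
Proof.
move=> fg g0; have [mf f0 fgi] := fg.
have mmono (i : I) : measurable_fun setT (monomial (val i) : 'rV[R]_n -> R).
  exact: measurable_monomial.
pose W (t : 'rV[R]_n) := 1 + \sum_(i : I) `|monomial (val i) t|.
have W1 t : 1 <= W t by rewrite lerDl sumr_ge0.
have W0 t : 0 < W t by exact: lt_le_trans ltr01 (W1 t).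
have mWV : measurable_fun setT (fun t => (W t)^-1).
  apply: measurable_continuous_rV => t.
  have Wt0 : W t != 0 by rewrite gt_eqF.
  have cS : continuous (fun t : 'rV[R]_n => \sum_(i : I) `|monomial (val i) t|).
    apply: continuous_big => [|i _ x]; first exact: add_continuous.
    exact: (cvg_norm (@continuous_monomial R n (val i) x)).
  exact: (cvgV Wt0 (cvgD (cvg_cst _) (cS t))).
pose b (j : I) (t : 'rV[R]_n) := monomial (val j) t / W t.
have mb j : measurable_fun setT (b j) by exact: measurable_funM.
have b1 j t : `|b j t| <= 1.
  rewrite normrM normfV (gtr0_norm (W0 t)) ler_pdivrMr// mul1r /W.
  by rewrite (bigD1 j)//= addrCA lerDl addr_ge0// sumr_ge0.
pose F (i j : I) (t : 'rV[R]_n) := monomial (val i) t * f t * b j t.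
have iF i j : lambda.-integrable T (fun t => (F i j t)%:E).
  have [fi _] := fgi i; apply: (le_integrable mT _ _ fi).
    apply/measurable_EFinP/measurable_funTS.
    by apply: measurable_funM => //; exact: measurable_funM.
  move=> t Tt; rewrite lee_fin /F normrM.
  by apply: ler_piMr.
pose M i j : R := fine (\int[lambda]_(t in T) (F i j t)%:E)%E.
have FM i j : (\int[lambda]_(t in T) (F i j t)%:E)%E = (M i j)%:E.
  by rewrite /M fineK//; exact: integrable_fin_num.
pose Mc i (c : I -> R) := \sum_(j : I) M i j * c j.
have iFc i (c : I -> R) :
    lambda.-integrable T (fun t => (\sum_(j : I) c j * F i j t)%:E) /\
    (\int[lambda]_(t in T) (\sum_(j : I) c j * F i j t)%:E)%E = (Mc i c)%:E.
  have [H1 H2] := integral_combination mT c (iF i) (FM i); split => //.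
  by rewrite H2; congr (_%:E); apply: eq_bigr => j _; rewrite mulrC.
have Mdef (c : I -> R) : \sum_i c i * Mc i c = 0 -> forall i, c i = 0.
  move=> c0 j; apply: contrapT => /eqP cj; apply: g0.
  apply: (moment_ae0 mT fg).
  pose p t := \sum_(i : I) c i * monomial (val i) t.
  have mp : measurable_fun setT p.
    by apply: measurable_sum => i; exact: measurable_funM.
  have pE t : \sum_(i : I) c i * (\sum_(k : I) c k * F i k t) =
      p t ^+ 2 * (f t / W t).
    rewrite expr2 -mulrA mulr_suml; apply: eq_bigr => i _.
    rewrite -mulrA; congr (_ * _); rewrite mulr_suml mulr_sumr.
    by apply: eq_bigr => k _; rewrite /F /b; ring.
  have pf0 t : 0 <= p t ^+ 2 * (f t / W t).
    by rewrite mulr_ge0 ?sqr_ge0// divr_ge0// ltW.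
  have aepf : ae_eq lambda T (fun t => (p t ^+ 2 * (f t / W t))%:E) (cst 0%E).
    apply/ae_eq_integral_abs => //.
      apply/measurable_EFinP/measurable_funTS/measurable_funM.
        exact: measurable_funX.
      exact: measurable_funM.
    have [_ iE] := integral_combination mT c (fun i => (iFc i c).1)
      (fun i => (iFc i c).2).
    rewrite c0 in iE; rewrite -[RHS]iE; apply: eq_integral => t _.
    by rewrite /= ger0_norm// pE.
  have ap : {ae lambda, forall t, p t <> 0}.
    exists [set t | p t = 0]; split.
    - rewrite -[X in measurable X]setTI.
      exact: (mp measurableT _ (measurable_set1 0)).
    - exact: null_moment_polynomial cj.
    - by move=> t /= /contrapT.
  move: aepf ap; apply: filterS2 => t pft pt Tt.
  have [/eqP] := pft Tt.
  rewrite mulf_eq0 sqrf_eq0 mulf_eq0 invr_eq0 (gt_eqF (W0 t)) orbF.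
  by case/orP => [/eqP//|/eqP ft0]; rewrite /= ft0.
have [C C0 HC] := definite_solvable Mdef.
exists (#|{: I}|%:R * C) => [|h]; first by rewrite mulr_ge0.
have [c cE cb] := HC h.
exists (fun t => \sum_(j : I) c j * b j t); split.
- by apply: measurable_sum => j; exact: measurable_funM.
- move=> t; apply: le_trans (ler_norm_sum _ _ _) _.
  rewrite -mulrA mulr_natl -sumr_const; apply: ler_sum => j _.
  by rewrite normrM; apply: le_trans (cb j); exact: ler_piMr.
- move=> i; have [Fi FiE] := iFc i c.
  have E t : monomial (val i) t * f t * (\sum_(j : I) c j * b j t) =
      \sum_(j : I) c j * F i j t.
    by rewrite mulr_sumr; apply: eq_bigr => j _; rewrite /F; ring.
  split; first by under eq_fun do rewrite E.
  by under eq_integral do rewrite E; rewrite FiE /Mc cE.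
Qed.

Lemma G_TI_open g : G_TI T I g -> exists2 e : R, 0 < e &
  forall h : {ptws I -> R}, (forall i, `|h i - g i| < e) -> G_TI T I h.
Proof.
move=> /(G_TIP mT o0)[g0 [f fg]]; have [mf f0 fgi] := fg.
have [C C0 HC] := moment_perturbation fg g0.
have go := moment_o_gt0 mT o0 fg g0.
pose N : R := #|{: I}|%:R.
have D0 : 0 < C * N + 1 by rewrite ltr_wpDl// mulr_ge0// ler0n.
(* Below g o, the new total mass is still positive; below the other bound, the
   relative change u of the density is at most 1. *)
pose e := Num.min (g o) (C * N + 1)^-1.
have e0 : 0 < e by rewrite lt_min go invr_gt0.
exists e => // h hg.
have [u [mu ub uh]] := HC (fun i => h i - g i).
have u1 t : `|u t| <= 1.
  have S1 : \sum_(i : I) `|h i - g i| <= N * e.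
    by rewrite /N mulr_natl -sumr_const; apply: ler_sum => i _; exact/ltW/hg.
  have eD : e * (C * N + 1) <= 1.
    by rewrite -ler_pdivlMr// div1r /e ge_min lexx orbT.
  apply: le_trans (ub t) _; apply: le_trans eD.
  apply: (le_trans (ler_wpM2l C0 S1)).
  by rewrite mulrDr mulr1 mulrA [e * _]mulrC lerDl ltW.
apply/(G_TIP mT o0); split.
  move=> /(congr1 (fun v => v o)) ho0; have := hg o; rewrite ho0 sub0r normrN.
  by rewrite gtr0_norm// lt_min ltxx.
exists (fun t => f t * (1 + u t)); split.
- by apply: measurable_funM => //; exact: measurable_funD.
- by move=> t; rewrite mulr_ge0//; have := u1 t; rewrite ler_norml; lra.
- move=> i; have [fi fiE] := fgi i; have [ui uiE] := uh i.
  have E t : (monomial (val i) t * (f t * (1 + u t)))%:E =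
      ((monomial (val i) t * f t)%:E + (monomial (val i) t * f t * u t)%:E)%E.
    by rewrite -EFinD mulrA mulrDr mulr1.
  split; first by under eq_fun do rewrite E; exact: integrableD.
  under eq_integral do rewrite E.
  by rewrite (integralD mT fi ui) fiE uiE -EFinD addrC subrK.
Qed.

End openness.

(** * Comparison of the two cones *)

Lemma regular_index0 n (I : {fset {ffun 'I_n -> nat}}) : regular_index I ->
  exists o : I, forall k, val o k = 0%N.
Proof.
move=> [/fset0Pn[i iI] Ireg].
have I0 : [ffun=> 0%N] \in I by apply: (Ireg i iI) => k; left; rewrite ffunE.
by exists [` I0]%fset => k; rewrite ffunE.
Qed.

Section comparison.
Context {R : realType} {n : nat}.
Variables (T : set 'rV[R]_n) (I : {fset {ffun 'I_n -> nat}}).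
Hypotheses (cT : closed T) (rT : regular_set T).
Variable o : I.
Hypothesis o0 : forall k, val o k = 0%N.

Let mT : measurable T.
Proof.
rewrite -[T]setCK; apply: measurableC; apply: sub_sigma_algebra.
exact: closed_openC.
Qed.

Lemma G_TI_nonempty : G_TI T I !=set0.
Proof.
have [[t0 Tt0] _] := rT.
have [|g Gg _] :=
  G_TI_local mT o0 (w := fun i => (i == o)%:R) rT Tt0.
  rewrite (bigD1 o)//= eqxx mul1r (monomial_o o0) ltr_wpDr// sumr_ge0//.
  by move=> i /negbTE ->; rewrite mul0r.
by exists g.
Qed.

Lemma Gamma_sub_closure : Gamma_TI T I `<=` closure (G_TI T I).
Proof.
move=> x [nu [_ xnu]]; apply: cone_duality.
- exact: G_TI_nonempty.
- by move=> g h; exact: (G_TID mT o0).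
- by move=> s g; exact: (G_TIZ mT o0).
move=> w wG.
have q0 t : T t -> \sum_(i : I) w i * monomial (val i) t <= 0.
  move=> Tt; rewrite leNgt; apply/negP => qt.
  have [g /wG] := G_TI_local mT o0 rT Tt qt.
  by move=> /le_lt_trans /[apply]; rewrite ltxx.
have ix (i : I) : nu.-integrable T (EFin \o monomial (val i)).
  apply/integrableP; split; last by have [] := xnu i.
  by apply/measurable_EFinP/measurable_funTS; exact: measurable_monomial.
have [iq iE] := integral_combination mT w ix (fun i => (xnu i).2).
rewrite -lee_fin /dot -iE -[leRHS](integral0 nu T).
apply: le_integral => //; first exact: integrable0.
by move=> t /set_mem /q0; rewrite lee_fin.
Qed.

(** For small s > 0 the point L s = x + s (x - g0) beyond x is still in Gamma, so
some y in G is close to it. Correcting g0 by (L s - y) / s gives a point g' that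
is still in the open set G, and x = (y + s g') / (1 + s). *)
Lemma interior_Gamma_sub : (Gamma_TI T I)° `<=` G_TI T I.
Proof.
move=> x Gx; have [g0 Gg0] := G_TI_nonempty.
have [e e0 He] := G_TI_open mT o0 Gg0.
pose L (s : R) : {ptws I -> R} := fun i => x i + s * (x i - g0 i).
have cL : L @ (0 : R)^'+ --> x.
  apply: (proj2 (@ptws_cvgP R I (L @ (0:R)^'+) x _)) => i.
  rewrite -[X in _ --> X]addr0 -[X in _ + X](mul0r (x i - g0 i)).
  apply: cvgD; first exact: cvg_cst.
  apply: cvgM; last exact: cvg_cst.
  exact: cvg_at_right_filter cvg_id.
have [s [/= s0 Gs]] : exists s : R, 0 < s /\ Gamma_TI T I (L s).
  near (0 : R)^'+ => s; exists s; split; first by near: s; exact: nbhs_right_gt.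
  by near: s; exact: (cL _ Gx).
have [y [Gy yL]] :=
  Gamma_sub_closure Gs (nbhs_ptws_box (L s) (mulr_gt0 s0 e0)).
pose g' : {ptws I -> R} := fun i => g0 i + s^-1 * (L s i - y i).
have Gg' : G_TI T I g'.
  apply: He => i; rewrite /g' addrAC subrr add0r normrM gtr0_norm ?invr_gt0//.
  by rewrite mulrC ltr_pdivrMr// distrC mulrC.
have -> : x = (fun i => (1 + s)^-1 * (y i + s * g' i)).
  apply/funext => i; rewrite /g' /L.
  by field; rewrite !gt_eqF//; lra.
apply: (G_TIZ mT o0); first by rewrite invr_gt0; lra.
by apply: (G_TID mT o0) => //; exact: (G_TIZ mT o0).
Unshelve. all: by end_near. Qed.

Lemma G_TI_sub_interior : G_TI T I `<=` (Gamma_TI T I)°.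
Proof.
move=> g Gg; have [e e0 He] := G_TI_open mT o0 Gg.
have sub : [set h : {ptws I -> R} | forall i, `|h i - g i| < e] `<=`
    Gamma_TI T I.
  move=> h hg; have [_ [f fh]] := (G_TIP mT o0 h).1 (He h hg).
  exact: (moment_density_Gamma mT fh).
exact: (@filterS _ (nbhs g) (nbhs_filter g) _ _ sub (nbhs_ptws_box g e0)).
Qed.

End comparison.

Theorem theorem6 (R : realType) (n : nat) (T : set 'rV[R]_n)
    (I : {fset {ffun 'I_n -> nat}}) :
  closed T -> regular_set T -> regular_index I ->
  G_TI T I = (Gamma_TI T I)° /\ dense_in (G_TI T I) (Gamma_TI T I).
Proof.
move=> cT rT /regular_index0[i0 i00].
have GsubI := G_TI_sub_interior cT i00.
split; last first.
  split; last exact: Gamma_sub_closure cT rT _ i00.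
  exact: subset_trans GsubI (@interior_subset _ _).
by apply/seteqP; split => //; exact: interior_Gamma_sub cT rT _ i00.
Qed.
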